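(* (1) Let $m\ge1$ and let $\lambda_1\le\lambda_2\le\cdots\le\lambda_m$ be real numbers, and let $\Lambda_1$ be the multiset $\{\lambda_1,\lambda_1,\lambda_2,\lambda_2,\dots,\lambda_m,\lambda_m,0\}$. Then there exists a weighted graph $W_1$ with $2m+1$ vertices such that the multiset of eigenvalues of its Laplacian is $\operatorname{spec}(L_{W_1})=\Lambda_1$. (2) Let $m\ge 1$, let $\lambda_1\le\cdots\le\lambda_{m-1}$ and $\lambda$ be real numbers, and let $\Lambda_2$ be the multiset $\{\lambda_1,\lambda_1,\dots,\lambda_{m-1},\lambda_{m-1},0,\lambda\}$. Then there exists a weighted graph $W_2$ with $2m$ vertices such that $\operatorname{spec}(L_{W_2})=\Lambda_2$.
   Context: A weighted graph is a simple graph on vertices $v_1,\dots,v_n$ together with a real (possibly negative) weight on each edge; its adjacency matrix $A$ is the symmetric $n\times n$ matrix whose $(i,j)$ entry is the weight of edge $v_iv_j$ (and $0$ if there is no edge, including on the diagonal), its degree matrix $D$ is the diagonal matrix whose $(i,i)$ entry is the sum of the $i$th row of $A$, and its Laplacian is $L=D-A$. $\operatorname{spec}(L)$ denotes the multiset of eigenvalues of $L$. *)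

(* Defs.v *)
From mathcomp Require Import all_boot all_order all_algebra.
From mathcomp Require Import reals.

Set Implicit Arguments.
Unset Strict Implicit.
Unset Printing Implicit Defensive.

Import Order.TTheory GRing.Theory Num.Theory.
Local Open Scope ring_scope.

(* [weight i j] is only meaningful when [edge i j] holds; its values on
   non-edges are never used, see [adjacency]. *)
Record wgraph (R : realType) (n : nat) := WGraph {
  edge : rel 'I_n;
  edge_sym : symmetric edge;
  edge_irr : irreflexive edge;
  weight : 'I_n -> 'I_n -> R;
  weight_sym : forall i j, edge i j -> weight i j = weight j i
}.

Definition adjacency (R : realType) (n : nat) (W : wgraph R n) : 'M[R]_n :=
  \matrix_(i, j) (if edge W i j then weight W i j else 0).

Definition degree_mx (R : realType) (n : nat) (W : wgraph R n) : 'M[R]_n :=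
  diag_mx (\row_i \sum_j adjacency W i j).

Definition laplacian (R : realType) (n : nat) (W : wgraph R n) : 'M[R]_n :=
  degree_mx W - adjacency W.

(* Multisets are represented by sequences up to permutation: [s] lists all
   the eigenvalues of [A] with their algebraic multiplicities. In particular
   [size s = n], so that [A] has no eigenvalue outside of [R]. *)
Definition has_spec (R : realType) (n : nat) (A : 'M[R]_n) (s : seq R) : Prop :=
  char_poly A = \prod_(x <- s) ('X - x%:P).

Lemma has_spec_perm (R : realType) (n : nat) (A : 'M[R]_n) (s t : seq R) :
  has_spec A s -> has_spec A t <-> perm_eq s t.
Proof.
rewrite /has_spec => ->; split => [/esym/prod_XsubC_eq|st].
  by rewrite perm_sym.
by rewrite (perm_big _ st).
Qed.

Lemma has_spec_eigenvalue (R : realType) (n : nat) (A : 'M[R]_n) (s : seq R) :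
  has_spec A s -> eigenvalue A =i s.
Proof.
by move=> As x; rewrite -[RHS]root_prod_XsubC -As -eigenvalue_root_char.
Qed.

Definition doubled (R : realType) (k : nat) (lam : 'I_k -> R) : seq R :=
  flatten [seq [:: lam i; lam i] | i <- enum 'I_k].

(* Main.v *)
(** Every finite real multiset containing 0 is the spectrum of a weighted
    Laplacian, so the pairing of the eigenvalues plays no role. If [L] is a
    Laplacian on [n] vertices with spectrum [0, mu_1, ..., mu_(n-1)], then
    joining a new vertex to all the others by edges of weight [w] gives a
    Laplacian with spectrum [0, (n + 1) w, mu_1 + w, ..., mu_(n-1) + w].
    Choosing [w] and shifting the [mu_i] accordingly, one adds any prescribed
    eigenvalue. The induction is carried out on the determinant of
    [x I - L - c J], with [J] the all-ones matrix and [x], [c] arbitrary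
    polynomials: this form is stable under both the shift by [w] and the
    rank-one perturbation that eliminating the new vertex produces. *)

Require Import Defs.
From mathcomp Require Import all_boot all_order all_algebra.
From mathcomp Require Import reals.
From mathcomp Require Import ring.

Import Order.TTheory GRing.Theory Num.Theory.
Local Open Scope ring_scope.

(** Adding all other columns to the first makes it constant equal to [r]; subtracting the first row
    from the others then clears it below the corner. The single matrix [P] encodes both
    operations. *)
Lemma det_block_constant_row_sums (S : comNzRingType) (n : nat) (r : S)
    (a : 'M[S]_1) (b : 'rV[S]_n) (d : 'cV[S]_n) (B : 'M[S]_n) :
  a + b *m const_mx 1 = r%:M -> d + B *m const_mx 1 = const_mx r ->
  \det (block_mx a b d B) = r * \det (B - const_mx 1 *m b).
Proof.
move=> ab_r dB_r.
pose P : 'M[S]_(1 + n) := block_mx 1%:M 0 (const_mx 1) 1%:M.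
have detP : \det P = 1 by rewrite det_lblock !det1 mulr1.
have MP : block_mx a b d B *m P
          = P *m block_mx r%:M b 0 (B - const_mx 1 *m b).
  rewrite !mulmx_block !mulmx1 !mul1mx !mulmx0 !mul0mx !add0r !addr0.
  rewrite ab_r dB_r [const_mx 1 *m b + _]addrC subrK.
  by rewrite mul_mx_scalar scalemx_const mulr1.
have /(congr1 determinant) := MP.
by rewrite !det_mulmx detP mulr1 mul1r det_ublock det_scalar1.
Qed.

Lemma mul_const_mx (S : pzRingType) (m n p : nat) (a b : S) :
  (const_mx a : 'M_(m, n)) *m (const_mx b : 'M_(n, p))
  = const_mx ((a * b) *+ n).
Proof.
apply/matrixP => i j; rewrite !mxE.
under eq_bigr do rewrite !mxE.
by rewrite sumr_const card_ord.
Qed.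

(** For a Laplacian [L], this is the Laplacian after joining a new first vertex to all others with
    weight [w]. *)
Definition cone_mx {S : pzRingType} {n : nat} (w : S) (L : 'M[S]_n) :
    'M[S]_(1 + n) :=
  block_mx (w *+ n)%:M (const_mx (- w)) (const_mx (- w)) (L + w%:M).

Lemma tr_cone_mx (S : pzRingType) (n : nat) (w : S) (L : 'M[S]_n) :
  L^T = L -> (cone_mx w L)^T = cone_mx w L.
Proof.
by move=> symL; rewrite tr_block_mx !trmx_const raddfD /= !tr_scalar_mx symL.
Qed.

Lemma cone_mx_row_sums (S : comNzRingType) (n : nat) (w : S) (L : 'M[S]_n) :
  L *m (const_mx 1 : 'cV_n) = 0 ->
  cone_mx w L *m (const_mx 1 : 'cV_(1 + n)) = 0.
Proof.
move=> L1; rewrite -col_mx_const mul_block_col mulmxDl L1 add0r.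
rewrite !mul_scalar_mx !scalemx_const !mul_const_mx !mulr1 mulr1n mulNrn.
by rewrite -col_mx0; congr col_mx; apply/matrixP => i j; rewrite !mxE;
  rewrite ?subrr ?addNr.
Qed.

Lemma map_cone_mx (S T : pzRingType) (f : {rmorphism S -> T}) (n : nat)
    (w : S) (L : 'M[S]_n) :
  map_mx f (cone_mx w L) = cone_mx (f w) (map_mx f L).
Proof.
by rewrite map_block_mx !map_const_mx map_mxD !map_scalar_mx /= rmorphN rmorphMn.
Qed.

(** All row sums equal [x - c *+ n.+1]. In the remaining block, subtracting the row of entries
    [w - c] turns the perturbation [c] into [w]. *)
Lemma det_cone_mx (S : comNzRingType) (n : nat) (w x c : S) (L : 'M[S]_n) :
  L *m (const_mx 1 : 'cV_n) = 0 ->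
  \det (x%:M - cone_mx w L - const_mx c)
  = (x - c *+ n.+1) * \det ((x - w)%:M - L - const_mx w).
Proof.
move=> L1.
have -> : x%:M - cone_mx w L - const_mx c
   = block_mx (x - w *+ n - c)%:M (const_mx (w - c)) (const_mx (w - c))
              ((x - w)%:M - L - const_mx c).
  rewrite (scalar_mx_block 1 n x) -(block_mx_const 1 n).
  rewrite !opp_block_mx !add_block_mx.
  by congr block_mx; apply/matrixP => i j; rewrite !mxE ?ord1 /=; ring.
rewrite (@det_block_constant_row_sums _ _ (x - c *+ n.+1)).
- congr (_ * \det _); apply/matrixP => i j; rewrite mul_const_mx !mxE /=; ring.
- rewrite mul_const_mx; apply/matrixP => i j; rewrite !mxE !ord1 /=; ring.
- rewrite !mulmxDl !mulNmx L1 mul_scalar_mx !mul_const_mx.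
  apply/matrixP => i j; rewrite !mxE /=; ring.
Qed.

Lemma exists_laplacian_mx (R : realType) (s : seq R) :
  exists L : 'M[R]_((size s).+1),
    [/\ L^T = L, L *m (const_mx 1 : 'cV_((size s).+1)) = 0 &
      forall x c : {poly R},
        \det (x%:M - map_mx polyC L - const_mx c)
        = (x - c *+ (size s).+1) * \prod_(mu <- s) (x - mu%:P)].
Proof.
(* Induction on the size, since the tail is shifted before the hypothesis is applied. *)
move: {2}(size s) (erefl (size s)) => n; elim: n s => [|n IHn] [|mu s] //=.
  move=> _; exists 0; split; rewrite ?trmx0 ?mul0mx // => x c.
  by rewrite det_mx11 big_nil !mxE /= subr0 mulr1n !mulr1.
(* The hypothesis is used at [x - w] and [c = w]: its linear factor becomes [x - w *+ (size s).+2],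
   which must be [x - mu]. *)
move=> [size_s]; pose w := mu / (size s).+2%:R.
have [] := IHn [seq nu - w | nu <- s]; first by rewrite size_map.
rewrite size_map => L [symL L1 detL]; exists (cone_mx w L).
split; [exact: tr_cone_mx | exact: cone_mx_row_sums|move=> x c].
have L1P : map_mx polyC L *m (const_mx 1 : 'cV_((size s).+1)) = 0.
  have /(congr1 (map_mx (@polyC R))) := L1.
  by rewrite map_mxM map_const_mx map_mx0.
rewrite map_cone_mx /= det_cone_mx // detL big_map big_cons.
have -> : mu = w *+ (size s).+2 by rewrite -mulr_natr divfK // pnatr_eq0.
congr (_ * (_ * _)).
  by rewrite polyCMn; ring.
by apply: eq_bigr => nu _; rewrite polyCB; ring.
Qed.

(** The complete graph with weights [- L i j], zero allowed, works: zero row sums force the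
    diagonal. *)
Lemma laplacian_of_zero_row_sums (R : realType) (n : nat) (L : 'M[R]_n) :
  L^T = L -> L *m (const_mx 1 : 'cV_n) = 0 ->
  exists W : wgraph R n, laplacian W = L.
Proof.
move=> symL L1.
have edge_sym : symmetric (fun i j : 'I_n => i != j).
  by move=> i j; rewrite eq_sym.
have edge_irr : irreflexive (fun i j : 'I_n => i != j).
  by move=> i; rewrite eqxx.
have weight_sym (i j : 'I_n) : i != j -> - L i j = - L j i.
  by rewrite -[in LHS]symL mxE.
exists (WGraph edge_sym edge_irr weight_sym); apply/matrixP => i j.
rewrite !mxE /=; have [<-|ij] := eqVneq i j; last by rewrite mulr0n sub0r opprK.
rewrite mulr1n subr0.
have /matrixP/(_ i 0) := L1; rewrite !mxE (bigD1 i) //= mxE mulr1.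
move/eqP; rewrite addr_eq0 => /eqP ->; rewrite -sumrN.
rewrite (bigD1 i) //= mxE /= eqxx add0r.
by apply: eq_bigr => k ki; rewrite !mxE /= mulr1 eq_sym ki.
Qed.

Lemma exists_wgraph_spec (R : realType) (n : nat) (s t : seq R) :
  n = (size s).+1 -> perm_eq (0 :: s) t ->
  exists W : wgraph R n, has_spec (laplacian W) t.
Proof.
move=> -> st; have [L [symL L1 detL]] := exists_laplacian_mx R s.
have [W WL] := laplacian_of_zero_row_sums R _ L symL L1; exists W.
rewrite /has_spec -(perm_big _ st) big_cons /= WL polyC0 subr0.
(* At [c = 0] the determinant is the characteristic polynomial, and the linear factor is ['X], for
   the eigenvalue 0. *)
by have := detL 'X 0; rewrite mul0rn !subr0 => <-.
Qed.

Lemma size_doubled (R : realType) (k : nat) (lam : 'I_k -> R) :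
  size (doubled lam) = (2 * k)%N.
Proof.
rewrite size_flatten sumnE 2!big_map big_enum /=.
by rewrite sum_nat_const card_ord mulnC.
Qed.

Theorem theorem5p1 (R : realType) :
  (forall (m : nat) (lam : 'I_m -> R),
     (1 <= m)%N ->
     (forall i j : 'I_m, (i <= j)%N -> lam i <= lam j) ->
     exists W1 : wgraph R (2 * m + 1),
       has_spec (laplacian W1) (doubled lam ++ [:: 0])) /\
  (forall (m : nat) (lam : 'I_(m.-1) -> R) (lambda : R),
     (1 <= m)%N ->
     (forall i j : 'I_(m.-1), (i <= j)%N -> lam i <= lam j) ->
     exists W2 : wgraph R (2 * m),
       has_spec (laplacian W2) (doubled lam ++ [:: 0; lambda])).
Proof.
split=> [m lam _ _|m lam lambda m_gt0 _].
  apply: (@exists_wgraph_spec _ _ (doubled lam)).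
    by rewrite size_doubled addn1.
  by rewrite -cat1s perm_catC.
apply: (@exists_wgraph_spec _ _ (rcons (doubled lam) lambda)).
  by rewrite size_rcons size_doubled -[in LHS](prednK m_gt0) mulnS.
by rewrite -cats1 -(cat1s 0 [:: lambda]) catA -cat_cons perm_cat2r -cat1s perm_catC.
Qed.
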